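(* Let $a\ne b$. The spherical tilings by $12$ edge congruent pentagons with edge lengths $a,a,a,a,b$ are, up to symmetries, given by the following five assignments of lengths to the edges of the dodecahedral pattern, in each of which the six listed edges have length $b$ and all other edges have length $a$: (1) $E_{1,5},E_{2,6},E_{3,4},E_{7,12},E_{8,9},E_{10,11}$; (2) $E_{1,5},E_{2,6},E_{3,4},E_{11,12},E_{7,8},E_{9,10}$; (3) $E_{1,5},E_{2,6},E_{3,4},E_{10,12},E_{7,11},E_{8,9}$; (4) $E_{1,5},E_{2,6},E_{3,7},E_{4,8},E_{11,12},E_{9,10}$; (5) $E_{1,5},E_{2,3},E_{6,11},E_{4,8},E_{7,12},E_{9,10}$.
   Context: A spherical tiling by $12$ pentagons (graph embedded in $S^2$ with all vertices of degree $\ge 3$, every tile a five-edged region enclosed by a simple closed curve; edges may be any nice curves) is combinatorially the dodecahedral pattern: tiles $P_1,\dots,P_{12}$, where $P_i$ with list $(n_1,\dots,n_5)$ has edges in cyclic order $E_{i,n_1},\dots,E_{i,n_5}$, $E_{i,j}=E_{j,i}$ being the common edge of $P_i$ and $P_j$, and (with $n_6=n_1$) $E_{i,n_k},E_{i,n_{k+1}}$ meet at the vertex $V_{i,n_k,n_{k+1}}$ of degree $3$ shared by $P_i,P_{n_k},P_{n_{k+1}}$: $P_1:(2,3,4,5,6)$; $P_2:(1,6,11,7,3)$; $P_3:(1,2,7,8,4)$; $P_4:(1,3,8,9,5)$; $P_5:(1,4,9,10,6)$; $P_6:(1,5,10,11,2)$; $P_7:(12,8,3,2,11)$; $P_8:(12,9,4,3,7)$;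 $P_9:(12,10,5,4,8)$; $P_{10}:(12,11,6,5,9)$; $P_{11}:(12,7,2,6,10)$; $P_{12}:(7,11,10,9,8)$. An edge congruent tiling is considered as an assignment of lengths to the $30$ edges such that all tiles are edge congruent, i.e. for any two tiles there is an adjacency-preserving correspondence of their edges that preserves lengths. No geometric realization by great arcs is required. ''Up to symmetries'' means up to symmetries of the dodecahedral pattern (including reflections). *)

(* Defs.v *)
From mathcomp Require Import all_boot all_order all_algebra all_fingroup.
From mathcomp Require Import reals.

Set Implicit Arguments.
Unset Strict Implicit.
Unset Printing Implicit Defensive.

(* MathComp world.  The tile P_n, for 1 <= n <= 12, is the ordinal n - 1. *)
Notation tile := 'I_12.

Definition P (n : nat) : tile := @inZp 11 n.-1.

Definition pattern : seq (seq nat) :=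
  [:: [:: 2; 3; 4; 5; 6];
      [:: 1; 6; 11; 7; 3];
      [:: 1; 2; 7; 8; 4];
      [:: 1; 3; 8; 9; 5];
      [:: 1; 4; 9; 10; 6];
      [:: 1; 5; 10; 11; 2];
      [:: 12; 8; 3; 2; 11];
      [:: 12; 9; 4; 3; 7];
      [:: 12; 10; 5; 4; 8];
      [:: 12; 11; 6; 5; 9];
      [:: 12; 7; 2; 6; 10];
      [:: 7; 11; 10; 9; 8]].

(* The k-th neighbour of a tile in the cyclic order of its edges, k taken
   in {0, ..., 4}; ordS is the cyclic successor on 'I_5. *)
Definition nbr (i : tile) (k : 'I_5) : tile :=
  P (nth 0 (nth [::] pattern i) k).

(* E i j is the edge E_{i,j} when P_i and P_j are neighbours: an edge is
   identified with the pair of tiles it separates, so E_{i,j} = E_{j,i}.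
   Likewise a vertex is identified with the three tiles meeting there. *)
Definition E (i j : nat) : {set tile} := [set P i; P j].

Definition is_edge (e : {set tile}) : bool :=
  [exists i : tile, exists k : 'I_5, e == [set i; nbr i k]].

Definition is_vertex (v : {set tile}) : bool :=
  [exists i : tile, exists k : 'I_5, v == [set i; nbr i k; nbr i (ordS k)]].

Definition edge : Type := {e : {set tile} | is_edge e}.

Lemma is_edge_nbr (i : tile) (k : 'I_5) : is_edge [set i; nbr i k].
Proof. by apply/existsP; exists i; apply/existsP; exists k. Qed.

Definition tile_edge (i : tile) (k : 'I_5) : edge :=
  exist (fun e => is_edge e) [set i; nbr i k] (is_edge_nbr i k).

(* A symmetry (orientation-preserving or not) is given by its action on the
   tiles; the incidences of tiles with edges and vertices are preserved. *)
Definition is_symmetry (s : {perm tile}) : Prop :=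
  (forall e : {set tile}, is_edge e -> is_edge (s @: e)) /\
  (forall v : {set tile}, is_vertex v -> is_vertex (s @: v)).

Definition edge_image (s : {perm tile}) (hs : is_symmetry s) (e : edge) : edge :=
  exist (fun e => is_edge e) (s @: sval e) (proj1 hs (sval e) (svalP e)).

Section Lengths.
Variable R : realType.
Implicit Types (len : edge -> R) (a b : R).

Definition same_up_to_symmetry len1 len2 : Prop :=
  exists (s : {perm tile}) (hs : is_symmetry s),
    forall e : edge, len2 (edge_image hs e) = len1 e.

Definition adjacent5 (k l : 'I_5) : bool := (l == ordS k) || (k == ordS l).

Definition edge_congruent len (i j : tile) : Prop :=
  exists f : {perm 'I_5},
    (forall k l, adjacent5 (f k) (f l) = adjacent5 k l) /\
    (forall k, len (tile_edge j (f k)) = len (tile_edge i k)).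

Definition edge_congruent_tiling len : Prop :=
  forall i j : tile, edge_congruent len i j.

Definition tile_lengths len (i : tile) : seq R :=
  [seq len (tile_edge i k) | k <- enum 'I_5].

Definition two_length_assignment a b (B : seq {set tile}) : edge -> R :=
  fun e => if sval e \in B then b else a.

End Lengths.

Definition b_edges : 5.-tuple (seq {set tile}) :=
  [tuple [:: E 1 5; E 2 6; E 3 4; E 7 12; E 8 9; E 10 11];
         [:: E 1 5; E 2 6; E 3 4; E 11 12; E 7 8; E 9 10];
         [:: E 1 5; E 2 6; E 3 4; E 10 12; E 7 11; E 8 9];
         [:: E 1 5; E 2 6; E 3 7; E 4 8; E 11 12; E 9 10];
         [:: E 1 5; E 2 3; E 6 11; E 4 8; E 7 12; E 9 10]].

(* Main.v *)
(* The lengths a, a, a, a, b occur around every tile exactly when each tile has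
   one b-edge, i.e. when the b-edges form a perfect matching of the adjacency
   graph of the tiles (the icosahedron); rotating the tiles then gives the edge
   congruences.  In that graph any three mutually adjacent tiles share a vertex,
   so the symmetries are exactly its automorphisms.  A finite computation lists
   its 125 perfect matchings and 120 automorphisms, and finds that the
   automorphisms carry every matching to exactly one of the five given. *)
Require Import Defs.
From mathcomp Require Import all_boot all_order all_algebra all_fingroup.
From mathcomp Require Import reals zify.
Import Order.TTheory GRing.Theory Num.Theory.
Local Open Scope ring_scope.

(** * Finite checks by evaluation *)

(** Quantifiers over ordinals become boolean tests over [iota], on natural numbers only, which
    [vm_compute] evaluates. *)
Lemma all_ord n (p : pred nat) (i : 'I_n) : all p (iota 0 n) -> p i.
Proof. by move/allP; apply; rewrite mem_iota /=. Qed.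

Lemma all_ord2 m n (p : nat -> pred nat) (i : 'I_m) (j : 'I_n) :
  all (fun i => all (p i) (iota 0 n)) (iota 0 m) -> p i j.
Proof. by move/(all_ord _ _ i)/all_ord. Qed.

Lemma all_ord3 l m n (p : nat -> nat -> pred nat)
    (i : 'I_l) (j : 'I_m) (k : 'I_n) :
  all (fun i => all (fun j => all (p i j) (iota 0 n)) (iota 0 m)) (iota 0 l) ->
  p i j k.
Proof. by move/(all_ord2 _ _ _ i j)/all_ord. Qed.

(** * Edges, vertices and symmetries through adjacency of tiles *)

Lemma set2_inj (T : finType) (i j x y : T) :
  [set i; j] = [set x; y] -> (i = x /\ j = y) \/ (i = y /\ j = x).
Proof.
move=> eq_ijxy; have := set21 i j; have := set22 i j.
have := set21 x y; have := set22 x y; rewrite -eq_ijxy => y_ij x_ij.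
rewrite eq_ijxy; move: y_ij x_ij => /set2P y_ij /set2P x_ij /set2P j_xy.
move=> /set2P; intuition congruence.
Qed.

(** [pattern] numbers the tiles from 1 while the ordinals start at 0, hence [j.+1]. *)
Definition adj (i j : nat) : bool := j.+1 \in nth [::] pattern i.

Definition nbr_nat (i k : nat) : nat :=
  ((nth 0 (nth [::] pattern i) k).-1 %% 12)%N.

Lemma nbr_inj (i : tile) : injective (nbr i).
Proof.
move=> k l /(congr1 val)/eqP eq_kl; apply/val_inj/eqP; move: eq_kl.
apply/implyP; apply: (all_ord3 12 5 5
  (fun i k l => (nbr_nat i k == nbr_nat i l) ==> (k == l)) i k l).
by vm_compute.
Qed.

Lemma adjP (i j : tile) : reflect (exists k, j = nbr i k) (adj i j).
Proof.
have ->: adj i j = has (fun k => nbr_nat i k == j) (iota 0 5).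
  apply/eqP; apply: (all_ord2 12 12
    (fun i j => adj i j == has (fun k => nbr_nat i k == j) (iota 0 5)) i j).
  by vm_compute.
apply: (iffP hasP) => [[k]|[k ->]].
  rewrite mem_iota /= => lt_k5 /eqP eq_j.
  by exists (Ordinal lt_k5); apply/val_inj/esym.
by exists (k : nat); rewrite ?mem_iota /=.
Qed.

Lemma adj_sym (i j : tile) : adj i j = adj j i.
Proof.
apply/eqP; apply: (all_ord2 12 12 (fun i j => adj i j == adj j i) i j).
by vm_compute.
Qed.

Lemma is_edge_adj (i j : tile) : is_edge [set i; j] = adj i j.
Proof.
apply/existsP/idP => [[x /existsP[k /eqP /set2_inj[]]]|/adjP[k ->]].
- by case=> -> ->; apply/adjP; exists k.
- by case=> -> ->; rewrite adj_sym; apply/adjP; exists k.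
- by exists i; apply/existsP; exists k.
Qed.

Lemma edgeP (e : edge) : exists i j : tile, adj i j /\ sval e = [set i; j].
Proof.
case: e => e ee /=; have /existsP[i /existsP[k /eqP eE]] := ee.
by exists i, (nbr i k); split=> //; apply/adjP; exists k.
Qed.

(** Vertices are the triangles of the adjacency graph: two neighbours of a tile are adjacent only
    when they follow each other around it. *)
Lemma is_vertexP (v : {set tile}) :
  reflect (exists i j k : tile,
             [/\ adj i j, adj i k, adj j k & v = [set i; j; k]])
          (is_vertex v).
Proof.
apply: (iffP existsP) => [[i /existsP[k /eqP ->]]|[i [j [k [ij ik jk ->]]]]].
  exists i, (nbr i k), (nbr i (ordS k)).
  split=> //; try by apply/adjP; eexists.
  apply: (all_ord2 12 5
    (fun i k => adj (nbr_nat i k) (nbr_nat i (k.+1 %% 5)%N)) i k).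
  by vm_compute.
have [q qE] := adjP _ _ ij; have [r rE] := adjP _ _ ik.
have: (r == ordS q) || (q == ordS r).
  move: jk; rewrite qE rE; apply/implyP.
  apply: (all_ord3 12 5 5 (fun i q r => adj (nbr_nat i q) (nbr_nat i r) ==>
    ((r == q.+1 %% 5) || (q == r.+1 %% 5))%N) i q r).
  by vm_compute.
case/orP=> /eqP eq_qr; exists i; apply/existsP.
  by exists q; rewrite qE rE eq_qr.
by exists r; rewrite qE rE eq_qr -!setUA (setUC [set nbr i (ordS r)]).
Qed.

Lemma symmetry_adj (s : {perm tile}) :
  is_symmetry s <-> forall i j, adj (s i) (s j) = adj i j.
Proof.
have imset_set2 i j : s @: [set i; j] = [set s i; s j].
  by rewrite imsetU !imset_set1.
split=> [[s_edge _] i j|s_adj].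
  rewrite -!is_edge_adj -imset_set2.
  (* An injective map of the finite set of edges into itself is onto, so [s] also reflects edges. *)
  pose Es := [set e | is_edge e].
  have Es_s : (fun e : {set tile} => s @: e) @: Es = Es.
    apply/eqP; rewrite eqEcard card_imset ?leqnn ?andbT.
      by apply/subsetP=> _ /imsetP[e + ->]; rewrite !inE => /s_edge.
    exact/imset_inj/perm_inj.
  have := mem_imset Es [set i; j] (imset_inj (@perm_inj _ s)).
  by rewrite Es_s !inE.
split=> [e|v].
  case/existsP=> i /existsP[k /eqP ->].
  by rewrite imset_set2 is_edge_adj s_adj; apply/adjP; exists k.
case/is_vertexP=> [i [j [k [ij ik jk ->]]]]; apply/is_vertexP.
by exists (s i), (s j), (s k); rewrite !s_adj imsetU imset_set2 imset_set1.
Qed.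

(** * Length assignments and perfect matchings *)

Lemma perm_eq_one_b (R : realType) (a b : R) (g : 'I_5 -> R) : a <> b ->
  perm_eq [seq g k | k <- enum 'I_5] [:: a; a; a; a; b] <->
  exists k, forall l, g l = if l == k then b else a.
Proof.
move=> /eqP neq_ab; split=> [g_ab|[k gE]].
  (* The value [b] occurs once in the list, so [g] takes it at a single index. *)
  have := seq.permP g_ab (pred1 b); rewrite count_map /= (negPf neq_ab) eqxx.
  rewrite -size_filter enumT -cardE => /mem_card1[k kP].
  exists k => l; have <- : (g l == b) = (l == k) := kP l.
  have: g l \in [:: a; a; a; a; b].
    by rewrite -(perm_mem g_ab) map_f ?mem_enum.
  by case: ifP => [/eqP //|gNb]; rewrite !inE gNb orbF !orbb => /eqP.
rewrite (eq_map gE) (map_comp (fun l => if l == k :> nat then b else a) val).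
rewrite val_enum_ord; apply/seq.permP=> p.
by case: k {gE} => -[|[|[|[|[|//]]]]] ? /=; lia.
Qed.

(* The addition of 'I_5 is the one modulo 5, so that ordS k = k + 1. *)
Lemma one_b_edge_congruent (R : realType) (a b : R) (len : edge -> R)
    (i j : tile) (ki kj : 'I_5) :
  (forall l, len (tile_edge i l) = if l == ki then b else a) ->
  (forall l, len (tile_edge j l) = if l == kj then b else a) ->
  edge_congruent len i j.
Proof.
(* The rotation by [kj - ki] takes the [b]-edge of [i] to that of [j]. *)
move=> lenE lenE'; exists (perm (addIr (kj - ki))).
have ordSE (k : 'I_5) : ordS k = k + 1 by apply/val_inj; rewrite /= addn1.
split=> k; first by move=> l; rewrite /adjacent5 !permE !ordSE -!(addrAC _ 1)
  !(inj_eq (addIr _)).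
by rewrite permE lenE lenE' -[X in _ == X](subrK ki) addrC (inj_eq (addrI _)).
Qed.

(* M i is the tile on the other side of the b-edge of the tile i. *)
Definition b_matching {R : realType} (a b : R) (M : tile -> tile)
    (len : edge -> R) : Prop :=
  forall (e : edge) i j,
    sval e = [set i; j] -> len e = if j == M i then b else a.

Lemma tile_lengths_b_matching (R : realType) (a b : R) (len : edge -> R) :
  a <> b ->
  (forall i, perm_eq (tile_lengths len i) [:: a; a; a; a; b]) ->
  exists M : tile -> tile,
    [/\ forall i : tile, adj i (M i), involutive M & b_matching a b M len].
Proof.
move=> neq_ab len_ab.
have /fin_all_exists[k lenE] (i : tile) :=
  (perm_eq_one_b _ a b _ neq_ab).1 (len_ab i).
pose M i := nbr i (k i); exists M.
have lenM : b_matching a b M len.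
  move=> e i j eE.
  have /adjP[l jE] : adj i j by rewrite -is_edge_adj -eE; case: (e).
  have -> : e = tile_edge i l by apply/val_inj; rewrite /= -jE.
  by rewrite lenE jE (inj_eq (nbr_inj i)).
split=> // i; first by apply/adjP; exists (k i).
(* Seen from [M i], the same edge has length [b], so it is also the [b]-edge of [M i]; thus
   [M (M i) = i]. *)
have := lenM (tile_edge i (k i)) (M i) i; rewrite /= setUC => /(_ erefl).
by rewrite lenE eqxx; case: eqP => // _ /esym.
Qed.

Lemma b_matching_tile_lengths (R : realType) (a b : R) (M : tile -> tile)
    (len : edge -> R) :
  a <> b -> (forall i : tile, adj i (M i)) -> b_matching a b M len ->
  edge_congruent_tiling len /\
  forall i, perm_eq (tile_lengths len i) [:: a; a; a; a; b].
Proof.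
move=> neq_ab M_adj lenM.
have one_b i : exists k, forall l,
    len (tile_edge i l) = if l == k then b else a.
  have [k kE] := adjP _ _ (M_adj i); exists k => l.
  by rewrite (lenM _ i (nbr i l)) // kE (inj_eq (nbr_inj i)).
split=> [i j|i]; last by apply/perm_eq_one_b.
have [ki kiP] := one_b i; have [kj kjP] := one_b j.
exact: one_b_edge_congruent kiP kjP.
Qed.

Lemma same_up_to_symmetry_b_matching (R : realType) (a b : R)
    (M : tile -> tile) (len1 len2 : edge -> R) :
  b_matching a b M len1 -> same_up_to_symmetry len1 len2 ->
  exists s : {perm tile}, (forall i j, adj (s i) (s j) = adj i j) /\
    b_matching a b (fun i => s (M (s^-1%g i))) len2.
Proof.
move=> lenM [s [hs len12]]; have s_adj := (symmetry_adj s).1 hs.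
exists s; split=> // e i j eE.
(* To use [len12], [e] is written as the image of an edge: [s] preserves and reflects adjacency, so
   the preimage of [e] is one. *)
have e'P : is_edge [set s^-1%g i; s^-1%g j].
  by rewrite is_edge_adj -s_adj !permKV -is_edge_adj -eE; case: (e).
pose e' : edge := exist (fun e => is_edge e) _ e'P.
have -> : e = edge_image hs e'.
  by apply/val_inj; rewrite /= imsetU !imset_set1 !permKV.
rewrite len12 (lenM e' (s^-1%g i) (s^-1%g j)) //.
by rewrite -(inj_eq (@perm_inj _ s)) permKV.
Qed.

Lemma b_matching_same_up_to_symmetry (R : realType) (a b : R)
    (M N : tile -> tile) (len1 len2 : edge -> R) (s : {perm tile}) :
  (forall i j, adj (s i) (s j) = adj i j) ->
  (forall i, s (M i) = N (s i)) ->
  b_matching a b M len1 -> b_matching a b N len2 ->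
  same_up_to_symmetry len1 len2.
Proof.
move=> s_adj sMN lenM lenN; have hs := (symmetry_adj s).2 s_adj.
exists s, hs => e; have [i [j [_ eE]]] := edgeP e.
rewrite (lenM _ _ _ eE) (lenN _ (s i) (s j)); last first.
  by rewrite /= eE imsetU !imset_set1.
by rewrite -sMN (inj_eq (@perm_inj _ s)).
Qed.

(** As [a <> b], the lengths determine the matching: the edge from [i] to [M i] has length [b],
    which forces [N i = M i]. *)
Lemma b_matching_inj (R : realType) (a b : R) (M N : tile -> tile)
    (len : edge -> R) :
  a <> b -> (forall i : tile, adj i (M i)) ->
  b_matching a b M len -> b_matching a b N len -> M =1 N.
Proof.
move=> neq_ab M_adj lenM lenN i; have [k kE] := adjP _ _ (M_adj i).
have := lenN (tile_edge i k) i (M i); rewrite /= kE => /(_ erefl).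
rewrite (lenM _ i (nbr i k)) // -kE eqxx.
by case: eqP => // _ /esym.
Qed.

(** * Enumeration of matchings and automorphisms *)

Definition code (f : tile -> tile) : seq nat :=
  mkseq (fun k => f (inord k) : nat) 12.

Lemma nth_code f (i : tile) : nth 0%N (code f) i = f i.
Proof. by rewrite nth_mkseq ?inord_val. Qed.

(** Backtracking: lists are built entry by entry, and [ok l x] decides whether the prefix [l] may be
    followed by [x]. *)
Fixpoint search (ok : seq nat -> nat -> bool) (n : nat) : seq (seq nat) :=
  if n is n'.+1 then
    flatten [seq [seq rcons l x | x <- iota 0 12 & ok l x] | l <- search ok n']
  else [:: [::]].

(** Completeness of the search, by induction: the prefix is found and its next value survives the
    filter. *)
Lemma mem_search ok (f : nat -> nat) n :
  (forall k, (k < n)%N -> (f k < 12)%N && ok (mkseq f k) (f k)) ->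
  mkseq f n \in search ok n.
Proof.
elim: n => [//|n IHn] f_ok; rewrite mkseqS.
apply/flatten_mapP; exists (mkseq f n); first by apply: IHn => k /ltnW/f_ok.
have /andP[fn_lt fn_ok] := f_ok n (ltnSn n).
by apply: map_f; rewrite mem_filter fn_ok mem_iota.
Qed.

(** With [k = size l], being an involution is tested on pairs [j < k]: [j] is sent to [k] exactly
    when [k] is sent to [j]. *)
Definition extends_matching (l : seq nat) (x : nat) : bool :=
  adj (size l) x &&
  all (fun j => (nth 0%N l j == size l) == (x == j)) (iota 0 (size l)).

Definition extends_automorphism (l : seq nat) (x : nat) : bool :=
  (x \notin l) &&
  all (fun j => adj (nth 0%N l j) x == adj j (size l)) (iota 0 (size l)).

Definition matchings := search extends_matching 12.
Definition automorphisms := search extends_automorphism 12.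

Lemma mem_matchings (M : tile -> tile) :
  (forall i : tile, adj i (M i)) -> involutive M -> code M \in matchings.
Proof.
move=> M_adj MK; apply: (mem_search _ (fun k => M (inord k))) => k lt_k12.
rewrite ltn_ord andTb /extends_matching size_mkseq -{1}(inordK lt_k12) M_adj.
apply/allP=> j; rewrite mem_iota /= => lt_jk; rewrite nth_mkseq //.
rewrite -[X in (_ == X) == _](inordK lt_k12).
rewrite -[X in _ == (_ == X)](inordK (ltn_trans lt_jk lt_k12)).
by rewrite !(inj_eq val_inj) (can2_eq MK MK) [X in X == _]eq_sym.
Qed.

Lemma mem_automorphisms (s : {perm tile}) :
  (forall i j, adj (s i) (s j) = adj i j) -> code s \in automorphisms.
Proof.
move=> s_adj; apply: (mem_search _ (fun k => s (inord k))) => k lt_k12.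
rewrite ltn_ord andTb /extends_automorphism size_mkseq; apply/andP; split.
  apply/negP=> /mapP[j]; rewrite mem_iota /= => lt_jk /val_inj/perm_inj.
  move/(congr1 val) => /=; rewrite !inordK ?(ltn_trans lt_jk) // => eq_kj.
  by rewrite eq_kj ltnn in lt_jk.
apply/allP=> j; rewrite mem_iota /= => lt_jk; rewrite nth_mkseq // s_adj.
by rewrite !inordK ?(ltn_trans lt_jk).
Qed.

(** Soundness is not derived from the search: every list found is checked by evaluation to be an
    injective map of the tiles that preserves and reflects adjacency. *)
Lemma automorphisms_perm l : l \in automorphisms ->
  exists2 s : {perm tile}, forall i j, adj (s i) (s j) = adj i j &
    forall i, s i = nth 0%N l i :> nat.
Proof.
have: all (fun l =>
  [&& all (fun i => nth 0 l i < 12) (iota 0 12),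
      all (fun i => all (fun j => (nth 0 l i == nth 0 l j) ==> (i == j))
        (iota 0 12)) (iota 0 12) &
      all (fun i => all (fun j => adj (nth 0 l i) (nth 0 l j) == adj i j)
        (iota 0 12)) (iota 0 12)])%N automorphisms by vm_compute.
move/allP=> /[apply] /and3P[l_lt l_inj l_adj].
pose f i : tile := Ordinal (all_ord _ _ i l_lt).
have f_inj : injective f.
  move=> i j /(congr1 val) /eqP /= eq_ij.
  by apply/val_inj/eqP; apply: (implyP (all_ord2 _ _ _ i j l_inj)).
exists (perm f_inj) => i; last by rewrite permE.
by move=> j; rewrite !permE; apply/eqP; apply: (all_ord2 _ _ _ i j l_adj).
Qed.

(** * The five given matchings *)

(** The edges of [b_edges] as pairs of plain numbers, so that membership is decided by
    evaluation. *)
Definition b_pairs : seq (seq (nat * nat)) :=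
  [:: [:: (1, 5); (2, 6); (3, 4); (7, 12); (8, 9); (10, 11)];
      [:: (1, 5); (2, 6); (3, 4); (11, 12); (7, 8); (9, 10)];
      [:: (1, 5); (2, 6); (3, 4); (10, 12); (7, 11); (8, 9)];
      [:: (1, 5); (2, 6); (3, 7); (4, 8); (11, 12); (9, 10)];
      [:: (1, 5); (2, 3); (6, 11); (4, 8); (7, 12); (9, 10)]]%N.

Definition b_paired (n i j : nat) : bool :=
  ((i.+1, j.+1) \in nth [::] b_pairs n) ||
  ((j.+1, i.+1) \in nth [::] b_pairs n).

(* The i-th entry is the tile paired with i, tiles being numbered from 0. *)
Definition b_codes : seq (seq nat) :=
  [:: [:: 4; 5; 3; 2; 0; 1; 11; 8; 7; 10; 9; 6];
      [:: 4; 5; 3; 2; 0; 1; 7; 6; 9; 8; 11; 10];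
      [:: 4; 5; 3; 2; 0; 1; 10; 8; 7; 11; 6; 9];
      [:: 4; 5; 6; 7; 0; 1; 2; 3; 9; 8; 11; 10];
      [:: 4; 2; 1; 7; 0; 10; 11; 3; 9; 8; 5; 6]]%N.

Definition b_partner (n : nat) (i : tile) : tile :=
  inord (nth 0%N (nth [::] b_codes n) i).

Lemma nth_b_codes (n : 'I_5) (i : tile) :
  nth 0%N (nth [::] b_codes n) i = b_partner n i.
Proof.
(* All entries of the five codes are below 12, so [inord] never takes its default value. *)
rewrite inordK //.
apply: (all_ord2 5 12 (fun n i => nth 0 (nth [::] b_codes n) i < 12)%N n i).
by vm_compute.
Qed.

Lemma b_partnerP (n : 'I_5) (i j : tile) :
  b_paired n i j = (j == b_partner n i).
Proof.
rewrite -(inj_eq val_inj) /= -nth_b_codes; apply/eqP.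
apply: (all_ord3 5 12 12
  (fun n i j => b_paired n i j == (j == nth 0 (nth [::] b_codes n) i))%N n i j).
by vm_compute.
Qed.

Lemma b_partner_adj (n : 'I_5) (i : tile) : adj i (b_partner n i).
Proof.
rewrite -nth_b_codes; apply: (all_ord2 5 12
  (fun n i => adj i (nth 0 (nth [::] b_codes n) i))%N n i).
by vm_compute.
Qed.

Lemma b_edges_pairs (n : 'I_5) :
  tnth b_edges n = [seq E p.1 p.2 | p <- nth [::] b_pairs n].
Proof. by rewrite (tnth_nth [::]); case: n => -[|[|[|[|[|//]]]]]. Qed.

Lemma mem_b_edges (n : 'I_5) (i j : tile) :
  ([set i; j] \in tnth b_edges n) = b_paired n i j.
Proof.
have PK (x : tile) : P x.+1 = x by apply/val_inj; rewrite /= modn_small.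
rewrite b_edges_pairs; apply/mapP/orP => [[[p q] pq]|].
  (* [P] sends 0 and 1 to the same tile and reduces modulo 12, so recovering [p] and [q] from their
     tiles relies on this range. *)
  have /andP[/andP[p_gt0 le_p12] /andP[q_gt0 le_q12]] :
      ((0 < p <= 12) && (0 < q <= 12))%N.
    have: all (all (fun r => (0 < r.1 <= 12) && (0 < r.2 <= 12)))%N b_pairs.
      by [].
    have n_pairs : (n < size b_pairs)%N := ltn_ord n.
    by move/allP/(_ _ (mem_nth [::] n_pairs))/allP/(_ _ pq).
  have PS r : (0 < r <= 12)%N -> (P r).+1 = r.
    by case/andP=> r_gt0 ler; rewrite /= modn_small; lia.
  rewrite /E /= => /set2_inj[] [-> ->]; [left | right].
    by rewrite !PS ?p_gt0 ?q_gt0.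
  by rewrite !PS ?p_gt0 ?q_gt0.
case=> [ij|ji]; [exists (i.+1, j.+1) | exists (j.+1, i.+1)] => //.
  by rewrite /E !PK.
by rewrite /E !PK setUC.
Qed.

Lemma b_matching_b_edges (R : realType) (a b : R) (n : 'I_5) :
  b_matching a b (b_partner n) (two_length_assignment a b (tnth b_edges n)).
Proof.
by move=> e i j eE; rewrite /two_length_assignment eE mem_b_edges b_partnerP.
Qed.

(** * Classification up to automorphisms *)

(** The identity [l M = N l] for maps given by their lists: an automorphism [l] conjugates [M] into
    [N]. *)
Definition intertwines (l M N : seq nat) : bool :=
  all (fun i => nth 0 l (nth 0 M i) == nth 0 N (nth 0 l i))%N (iota 0 12).

(* The sequences are arguments, for vm_compute to evaluate them only once. *)
Definition all_intertwined (auts Ms Ns : seq (seq nat)) : bool :=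
  all (fun N => has (fun M => has (fun l => intertwines l M N) auts) Ms) Ns.

(** Evaluation finds for each listed matching a listed automorphism that conjugates one of the five
    codes into it. Completeness puts [M] in the list, and soundness turns the automorphism into a
    permutation. *)
Lemma matchings_classified (M : tile -> tile) :
  (forall i : tile, adj i (M i)) -> involutive M ->
  exists (n : 'I_5) (s : {perm tile}),
    (forall i j, adj (s i) (s j) = adj i j) /\
    forall i, s (b_partner n i) = M (s i).
Proof.
move=> M_adj MK.
have: all_intertwined automorphisms b_codes matchings by vm_compute.
move/allP/(_ _ (mem_matchings _ M_adj MK))/hasP=> [_ /(nthP [::])[n lt_n5 <-]].
case/hasP=> l /automorphisms_perm[s s_adj sE] lP.
exists (Ordinal lt_n5), s; split=> // i; apply/val_inj => /=.
rewrite sE -(nth_b_codes (Ordinal lt_n5)) -nth_code sE.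
exact/eqP/(all_ord _ _ i lP).
Qed.

(** The list contains every automorphism, and evaluation shows that none intertwines two different
    codes. *)
Lemma b_partner_inequivalent (m n : 'I_5) (s : {perm tile}) :
  (forall i j, adj (s i) (s j) = adj i j) ->
  (forall i, s (b_partner m i) = b_partner n (s i)) -> m = n.
Proof.
move=> /mem_automorphisms s_aut s_mn.
have: all (fun l => all (fun m => all (fun n =>
    intertwines l (nth [::] b_codes m) (nth [::] b_codes n) ==> (m == n))
  (iota 0 5)) (iota 0 5)) automorphisms by vm_compute.
move/allP/(_ _ s_aut)/(all_ord2 _ _ _ m n)/implyP => mn.
apply/val_inj/eqP/mn; apply/allP=> i; rewrite mem_iota /= => lt_i12.
have [k ->] : exists k : tile, i = k by exists (Ordinal lt_i12).
by rewrite nth_code !nth_b_codes nth_code s_mn.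
Qed.

Theorem proposition9 (R : realType) (a b : R)
    (ha : 0 < a) (hb : 0 < b) (hab : a <> b) :
  (forall len : edge -> R,
     (edge_congruent_tiling len /\
      forall i : tile, perm_eq (tile_lengths len i) [:: a; a; a; a; b])
     <->
     exists n : 'I_5,
       same_up_to_symmetry (two_length_assignment a b (tnth b_edges n)) len) /\
  (forall m n : 'I_5,
     same_up_to_symmetry (two_length_assignment a b (tnth b_edges m))
                         (two_length_assignment a b (tnth b_edges n)) ->
     m = n).
Proof.
have same_matching (n : 'I_5) len :=
  same_up_to_symmetry_b_matching _ _ _ _ _ len (b_matching_b_edges R a b n).
split=> [len|m n].
  split=> [[_ len_ab]|[n /same_matching[s [s_adj lenM]]]].
    have [M [M_adj MK lenM]] := tile_lengths_b_matching _ _ _ _ hab len_ab.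
    have [n [s [s_adj sM]]] := matchings_classified _ M_adj MK; exists n.
    have lenN := b_matching_b_edges _ a b n.
    exact: b_matching_same_up_to_symmetry s_adj sM lenN lenM.
  (* The conjugate matching still pairs adjacent tiles, [s] being an automorphism. *)
  apply: b_matching_tile_lengths hab _ lenM => i.
  by rewrite -{1}(permKV s i) s_adj b_partner_adj.
case/same_matching=> s [s_adj lenM].
(* The [n]-th assignment is described both by its own matching and by the conjugate under [s] of the
   [m]-th one, so these coincide. *)
have mn := b_matching_inj _ _ _ _ _ _ hab (b_partner_adj n)
  (b_matching_b_edges _ _ _ n) lenM.
by apply: (b_partner_inequivalent _ _ s s_adj) => i; rewrite mn permK.
Qed.
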